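(* Let $\mathcal{H}$ be a separable complex Hilbert space and let $A$ be a bounded prime dissipative operator with a rank one imaginary part acting in $\mathcal{H}$. Then there exists an orthonormal basis in $\mathcal{H}$ in which the matrix of the operator $A$ is a bounded Jacobi matrix (of size $n\times n$ if $\dim\mathcal{H}=n<\infty$, semi-infinite if $\dim\mathcal{H}=\infty$) with diagonal entries $b_1,b_2,\ldots$ and off-diagonal entries $a_1,a_2,\ldots$ satisfying $\operatorname{Im} b_1>0$, $b_k\in\mathbb{R}$ for all $k\ge 2$, and $a_k>0$ for all $k\geq 1$.
   Context: For a bounded operator $A$ in $\mathcal{H}$ put $A_R=\frac{A+A^*}{2}$ and $A_I=\frac{A-A^*}{2i}$ (the real and imaginary parts). $A$ is dissipative if $A_I\ge 0$; it has a rank one imaginary part if $\operatorname{rank}A_I=1$. $A$ is prime (completely non-self-adjoint) if there is no nonzero reducing subspace of $A$ on which $A$ is self-adjoint. A Jacobi matrix with entries $b_k$, $a_k$ is the (finite $n\times n$ or semi-infinite) tri-diagonal matrix with diagonal entries $b_1,b_2,\ldots$ and with both the entries in positions $(k,k+1)$ and $(k+1,k)$ equal to $a_k$. It is bounded if $\sup_k\{|a_k|+|b_k|\}<\infty$; it then defines a bounded operator in $\mathbb{C}^n$ or $l_2(\mathbb{N})$ by matrix multiplication. *)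

(* Defs.v *)
From HB Require Import structures.
From mathcomp Require Import all_boot all_order all_algebra complex.
From mathcomp Require Import all_classical all_reals all_analysis.
Import Order.TTheory GRing.Theory Num.Theory.
Import numFieldNormedType.Exports.

Set Implicit Arguments.
Unset Strict Implicit.
Unset Printing Implicit Defensive.

Local Open Scope classical_set_scope.
Local Open Scope ring_scope.
Local Open Scope complex_scope.

Definition separable (T : topologicalType) : Prop :=
  exists2 D : set T, countable D & dense D.

Section LinearNotions.
Context {R : realType} {V : lmodType R[i]}.
Implicit Types (W : set V).

Definition linear_subspace W : Prop :=
  W 0 /\ forall (c : R[i]) x y, W x -> W y -> W (c *: x + y).

Definition lin_span (I : Type) (e : I -> V) : set V :=
  [set x | exists (s : seq I) (c : I -> R[i]), x = \sum_(i <- s) c i *: e i].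

Definition lin_independent n (e : 'I_n -> V) : Prop :=
  forall c : 'I_n -> R[i], \sum_(i < n) c i *: e i = 0 -> forall i, c i = 0.

Definition has_dim W (n : nat) : Prop :=
  exists2 e : 'I_n -> V, lin_independent e & lin_span e = W.

Definition infinite_dim W : Prop := forall n, ~ has_dim W n.

Definition has_rank (B : V -> V) (n : nat) : Prop := has_dim (range B) n.

End LinearNotions.

(* A complex Hilbert space is a complete normed space V over R[i] together with
   a form dot : {dot V for Num.conj} (linear in its first argument) that
   satisfies induces_norm dot. Norms of vectors are nonnegative reals viewed in
   R[i], and 0 <= z in R[i] means that z is real and nonnegative. *)
Section HilbertSpace.
Context {R : realType} {V : completeNormedModType R[i]}.
Variable dot : {dot V for Num.conj}.
Implicit Types (A B : V -> V) (W : set V).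

Definition induces_norm : Prop := forall x, dot x x = `|x| ^+ 2.

(* A bounded operator on a Hilbert space has exactly one adjoint; on any other
   function the value of adjoint is irrelevant. *)
Definition adjoint A : V -> V :=
  get [set B : V -> V | forall x y, dot (A x) y = dot x (B y)].

Definition im_part A : V -> V :=
  fun x => (2 * 'i)^-1 *: (A x - adjoint A x).

Definition nonneg_operator B : Prop := forall x, 0 <= dot (B x) x.

Definition dissipative A : Prop := nonneg_operator (im_part A).

Definition orth_compl W : set V := [set x | forall w, W w -> dot x w = 0].

Definition invariant_under A W : Prop := forall x, W x -> W (A x).

Definition reducing A W : Prop :=
  [/\ linear_subspace W, closed W, invariant_under A W
    & invariant_under A (orth_compl W)].

Definition selfadjoint_on A W : Prop :=
  forall x y, W x -> W y -> dot (A x) y = dot x (A y).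

Definition prime_operator A : Prop :=
  forall W, reducing A W -> selfadjoint_on A W -> W = [set 0].

Definition orthonormal_family (I : eqType) (e : I -> V) : Prop :=
  forall i j, dot (e i) (e j) = (i == j)%:R.

Definition orthonormal_basis (I : eqType) (e : I -> V) : Prop :=
  orthonormal_family e /\ closure (lin_span e) = setT.

Definition op_entry A (I : Type) (e : I -> V) (j k : I) : R[i] :=
  dot (A (e k)) (e j).

End HilbertSpace.

Section Jacobi.
Context {R : realType}.
Implicit Types (b a : nat -> R[i]).

(* Entries are indexed from 0: b k and a k stand for b_{k+1} and a_{k+1}. *)
Definition jacobi_entry b a (j k : nat) : R[i] :=
  if j == k then b j
  else if k == j.+1 then a j
  else if j == k.+1 then a k
  else 0.

(* The n x n matrix only involves b k for k < n and a k for k.+1 < n,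
   so that its entries are automatically bounded. *)
Definition jacobi_mx n b a : 'M[R[i]]_n :=
  \matrix_(j < n, k < n) jacobi_entry b a j k.

Definition jacobi_bounded b a : Prop :=
  exists M : R, forall k, `|a k| + `|b k| <= M%:C.

End Jacobi.

(* Main.v *)
Require Import Defs.
From HB Require Import structures.
From mathcomp Require Import all_boot all_order all_algebra complex.
From mathcomp Require Import all_classical all_reals all_analysis.
From mathcomp Require Import ring lra.
Import Order.TTheory GRing.Theory Num.Theory.
Import numFieldNormedType.Exports.

Set Implicit Arguments.
Unset Strict Implicit.
Unset Printing Implicit Defensive.

Local Open Scope classical_set_scope.
Local Open Scope ring_scope.
Local Open Scope complex_scope.

(* By the Riesz theorem A* exists, and since Im A is nonnegative of rank one,
   A = H + i k <., g> g with H symmetric, |g| = 1 and k > 0.  The Lanczos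
   three-term recursion H e_k = a_(k-1) e_(k-1) + b_k e_k + a_k e_(k+1), started
   at e_0 = g, orthogonalizes g, H g, H^2 g, ...  A vector orthogonal to all e_k
   is also orthogonal to g, so these vectors form a reducing subspace on which
   A = H is self-adjoint; primality makes it trivial, hence the nonzero e_k form
   an orthonormal basis.  The recursion first breaks down (a_k = 0)
   exactly when the space has dimension k + 1, and the rank one term only alters
   the entry b_0, by i k. *)

(** * Cauchy-Schwarz inequality and orthogonal projection *)

Section HilbertGeometry.
Context {R : realType} {V : completeNormedModType R[i]}.
Variable dot : {dot V for Num.conj}.
Hypothesis hdot : induces_norm dot.
Implicit Types (M : set V) (x y z : V) (c : R[i]).

Lemma dotC x y : dot x y = ((dot y x)^*)%R.
Proof. by rewrite hermC expr0 mul1r. Qed.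

Lemma dot_eq0C x y : dot x y = 0 -> dot y x = 0.
Proof. by rewrite dotC => /eqP; rewrite conjC_eq0 => /eqP. Qed.

Lemma dotZr c x y : dot x (c *: y) = (c^*)%R * dot x y.
Proof. by rewrite linearZr_LR. Qed.

Lemma dotZl c x y : dot (c *: x) y = c * dot x y.
Proof. by rewrite linearZl_LR. Qed.

(** The exact defect in Cauchy-Schwarz, multiplied by the squared norm of [y] so as to cover
    [y = 0]. It serves again to show that a near-minimizer of the distance is nearly orthogonal. *)
Lemma sqr_norm_projection x y :
  `|x - (dot x y / dot y y) *: y| ^+ 2 * `|y| ^+ 2
    = `|x| ^+ 2 * `|y| ^+ 2 - `|dot x y| ^+ 2.
Proof.
have [->|y0] := eqVneq y 0.
  by rewrite linear0r normr0 expr0n !mulr0 normr0 expr0n subr0.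
have D0 : dot y y != 0 by rewrite dnorm_eq0.
rewrite -!hdot dnormB /= dnormZ dotZr !normCK !rmorphM/= !fmorphV /= conjCK.
rewrite ?(geC0_conj (dnorm_ge0 dot y)) -?dotC.
by field.
Qed.

Lemma dot_CauchySchwarz x y : `|dot x y| <= `|x| * `|y|.
Proof.
rewrite -(@ler_pXn2r _ 2) ?nnegrE ?mulr_ge0 // exprMn -subr_ge0.
by rewrite -sqr_norm_projection mulr_ge0 // exprn_ge0.
Qed.

Lemma ltr0c (r : R) : (0 < r%:C) = (0 < r).
Proof. exact: (ltcR 0 r). Qed.

(** Balls of [V] have radii in [R[i]]; a positive radius is real, so radii in [R] suffice. *)
Lemma closure_normP M z :
  closure M z <-> forall e : R, 0 < e -> exists2 m, M m & `|z - m| < e%:C.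
Proof.
split=> [clM e e0|clM B /nbhs_ballP[e /= e0 eB]].
  have [|m [Mm zm]] := clM (ball z e%:C); last first.
    by exists m => //; move: zm; rewrite -ball_normE.
  by apply: nbhsx_ballx; rewrite ltr0c.
have er : e = (complex.Re e)%:C by rewrite RRe_real ?gtr0_real.
have [|m Mm zm] := clM (complex.Re e); first by rewrite -ltr0c -er.
exists m; split => //; apply: eB; rewrite -ball_normE /=.
by rewrite er.
Qed.

(** The squared distance as an element of [R], where infima are available. *)
Let d2 x y := complex.Re (dot (x - y) (x - y)).

Lemma normE2 x y : `|x - y| ^+ 2 = (d2 x y)%:C.
Proof. by rewrite -hdot RRe_real // ger0_real // dnorm_ge0. Qed.

Lemma norm_small_eq0 (p : R[i]) :
  (forall e : R, 0 < e -> `|p| <= e%:C) -> p = 0.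
Proof.
move=> h; apply/eqP; rewrite -normr_eq0.
have pr : `|p| = (complex.Re `|p|)%:C by rewrite RRe_real.
have p0 : 0 <= complex.Re `|p| by rewrite -ler0c -pr.
rewrite pr; apply/eqP; congr (_%:C); apply/le_anti; rewrite p0 andbT.
apply/ler_addgt0Pl => e e0; rewrite addr0.
by rewrite -lecR -pr h.
Qed.

(** The foot [z] is the limit of a minimizing sequence in [M], hence a point of its closure. The
    sequence is Cauchy by the parallelogram law; orthogonality comes from an estimate along the
    sequence. *)
Lemma projection_theorem M x : linear_subspace M ->
  exists2 z, closure M z & orth_compl dot M (x - z).
Proof.
move=> [M0 MP].
pose d := inf [set d2 x m | m in M].
have d2ge0 u v : 0 <= d2 u v by rewrite -ler0c -normE2 exprn_ge0.
have dlb m : M m -> d <= d2 x m.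
  move=> Mm; apply: ge_inf; last by exists m.
  by exists 0 => _ [m' _ <-].
have mP n : {m | M m /\ d2 x m < d + n.+1%:R^-1}.
  apply: cid.
  have := @inf_adherent R [set d2 x m | m in M] n.+1%:R^-1.
  case; [by rewrite invr_gt0 | | by move=> _ [m Mm <-] ?; exists m].
  by split; [exists (d2 x 0); exists 0 | exists 0 => _ [m' _ <-]].
pose m n := sval (mP n).
have Mm n : M (m n) by rewrite /m; case: (mP n) => ? [].
have mlt n : d2 x (m n) < d + n.+1%:R^-1 by rewrite /m; case: (mP n) => ? [].
(* Parallelogram law for [x - m k] and [x - m l]: the midpoint lies in [M], hence at squared
   distance at least [d] from [x]. *)
have par k l : d2 (m k) (m l) <= 2 * (d2 x (m k) - d) + 2 * (d2 x (m l) - d).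
  have Mh : M (2^-1 *: m k + 2^-1 *: m l).
    by apply: (MP) => //; rewrite -[_ *: _]addr0; apply: (MP).
  have le1 := dlb _ Mh.
  have E : (d2 (m k) (m l))%:C =
     2 * (d2 x (m k))%:C + 2 * (d2 x (m l))%:C
        - 4 * (d2 x (2^-1 *: m k + 2^-1 *: m l))%:C.
    rewrite -!normE2 -!hdot.
    have -> : x - (2^-1 *: m k + 2^-1 *: m l) = 2^-1 *: ((x - m k) + (x - m l)).
      have xx : x = 2^-1 *: (x + x).
        by rewrite -mulr2n -[x *+ 2]scaler_nat scalerA
          mulVf ?pnatr_eq0 // scale1r.
      by rewrite [in LHS]xx -!scalerDr -scalerBr opprD addrACA.
    have -> : m k - m l = (x - m l) - (x - m k).
      by rewrite opprB [RHS]addrC addrA subrK.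
    move: (x - m k) (x - m l) => u v.
    rewrite dnormB dnormZ dnormD ger0_norm ?invr_ge0 ?ler0n //=.
    rewrite [dot v u]dotC conjCK.
    by field.
  move: le1 E; move: (d2 x (_ + _)) => h le1.
  rewrite -!(rmorph_nat (real_complex R)) -!rmorphM -!rmorphD -!rmorphN
     -rmorphD => /complexI ->.
  lra.
(* Such indices have excess [d2 x (m n) - d] below [e ^ 2 / 4]; twice the two excesses add up to
   less than [e ^ 2]. *)
have Cau k l e : 0 < e -> e^-1 ^+ 2 * 4 < k.+1%:R -> e^-1 ^+ 2 * 4 < l.+1%:R ->
   `|m k - m l| < e%:C.
  move=> e0 ke le.
  have H n : e^-1 ^+ 2 * 4 < n.+1%:R -> d2 x (m n) - d < e ^+ 2 / 4.
    move=> ne; have := mlt n; rewrite -ltrBlDl => /lt_le_trans; apply.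
    rewrite -[leRHS]invrK lef_pV2 ?posrE //
      ?invr_gt0 ?mulr_gt0 ?exprn_gt0 ?invr_gt0 //.
    by rewrite invfM invrK -exprVn ltW.
  rewrite -(@ltr_pXn2r _ 2) ?nnegrE ?ler0c ?(ltW e0) // normE2 -rmorphXn ltcR.
  apply: le_lt_trans (par k l) _.
  have := H _ ke; have := H _ le; lra.
have /cauchy_cvgP/cvg_ex[z zP] : cauchy (m @ \oo).
  apply/cauchy_exP => e e0.
  have er : e = (complex.Re e)%:C by rewrite RRe_real ?gtr0_real.
  have e'0 : 0 < complex.Re e by rewrite -ltr0c -er.
  have [N Ne] : exists N, (complex.Re e)^-1 ^+ 2 * 4 < N.+1%:R.
    exists (Num.truncn ((complex.Re e)^-1 ^+ 2 * 4)).
    exact: truncnS_gt.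
  exists (m N); exists N => // n /= Nn; rewrite -ball_normE /= er Cau //.
  by rewrite (lt_le_trans Ne) // ler_nat ltnS.
exists z.
  apply/closure_normP => e e0.
  have /cvgrPdist_lt/(_ e%:C) := zP; rewrite ltr0c => /(_ e0) [N _ /(_ N)] /=.
  by move=> /(_ (leqnn N)) ?; exists (m N).
move=> w Mw.
(* Shifting [m n] by the projection of [x - m n] on [w] stays in [M], so the squared distance cannot
   drop by more than the excess. *)
have dw n : `|dot (x - m n) w| ^+ 2 <= (d2 x (m n) - d)%:C * `|w| ^+ 2.
  have := sqr_norm_projection (x - m n) w.
  set c := _ / _ => cE.
  have Mc : M (c *: w + m n) by apply: (MP).
  have := dlb _ Mc; rewrite -lecR -normE2 opprD addrA (addrAC x).
  move=> /(ler_wpM2r (exprn_ge0 2 (normr_ge0 w))) /=.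
  rewrite cE [(_ - d)%:C]rmorphB mulrBl /= -normE2.
  by rewrite lerBrDl -lerBrDr.
apply: norm_small_eq0 => e e0.
pose W := complex.Re `|w|.
have WE : `|w| = W%:C by rewrite RRe_real.
have W0 : 0 <= W by rewrite -ler0c -WE.
(* Chosen so that [t * W <= e / 2]; the added 1 covers [W = 0]. *)
pose t := e / (2 * (W + 1)).
have t0 : 0 < t by rewrite divr_gt0 // mulr_gt0 // ltr_pwDr.
have tW : t * W <= e / 2.
  rewrite /t mulrAC ler_pdivrMr ?mulr_gt0 ?ltr_pwDr //.
  by rewrite mulrA divfK // ler_wpM2l ?(ltW e0) // lerDl.
have /cvgrPdist_lt/(_ t%:C) := zP; rewrite ltr0c => /(_ t0) [N _ zN].
have [K Ke] : exists K, (t ^+ 2)^-1 < K.+1%:R.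
  by exists (Num.truncn ((t ^+ 2)^-1)); exact: truncnS_gt.
(* From [N] on, [z - m n] has norm below [t]; from [K] on, the excess is at most [t ^ 2]. Each
   contributes at most [e / 2]. *)
pose n := maxn N K.
have -> : x - z = (x - m n) - (z - m n) by rewrite opprB addrA subrK.
rewrite linearBl /= (le_trans (ler_normB _ _)) //.
have -> : e%:C = (e / 2)%:C + (e / 2)%:C.
  by rewrite -rmorphD; congr (_%:C); field.
have tWC : t%:C * `|w| <= (e / 2)%:C by rewrite WE -rmorphM lecR.
apply: lerD; apply: le_trans tWC; last first.
  apply: le_trans (dot_CauchySchwarz _ _) _.
  apply: ler_wpM2r => //; apply/ltW/zN => /=; exact: leq_maxl.
rewrite -(@ler_pXn2r _ 2) ?nnegrE ?normr_ge0 ?mulr_ge0 ?ler0c ?(ltW t0) //.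
apply: le_trans (dw n) _; rewrite exprMn.
apply: ler_wpM2r; first exact: exprn_ge0.
rewrite -rmorphXn lecR lerBlDl (le_trans (ltW (mlt n))) // lerD2l.
rewrite -[leRHS]invrK lef_pV2 ?posrE // ?invr_gt0 ?exprn_gt0 //.
by rewrite (le_trans (ltW Ke)) // ler_nat ltnS leq_maxr.
Qed.

End HilbertGeometry.

(** * Riesz representation, adjoints, rank one imaginary parts and primality *)

Section BoundedOperators.
Context {R : realType} {V : completeNormedModType R[i]}.
Variable dot : {dot V for Num.conj}.
Hypothesis hdot : induces_norm dot.
Implicit Types (M : set V) (x y z : V) (c : R[i]).

Lemma bounded_vanish_closure (f : V -> R[i]) (C : R) M :
  (forall x y, f (x - y) = f x - f y) -> (forall x, `|f x| <= C%:C * `|x|) ->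
  (forall x, M x -> f x = 0) -> forall z, closure M z -> f z = 0.
Proof.
move=> fB fC fM z /closure_normP clz; apply: norm_small_eq0 => e e0.
pose D := `|C| + 1.
have D0 : 0 < D by rewrite ltr_pwDr.
have [|m Mm /ltW zm] := clz (e / D); first exact: divr_gt0.
have -> : f z = f (z - m) by rewrite fB (fM m) // subr0.
apply: le_trans (fC _) _.
have -> : e%:C = D%:C * (e / D)%:C.
  by rewrite -rmorphM mulrC divfK // gt_eqF.
apply: le_trans (ler_wpM2l _ zm); last by rewrite ler0c ltW.
apply: ler_wpM2r => //.
by rewrite lecR (le_trans (ler_norm C)) // lerDl.
Qed.

(** The kernel of [f] is closed, so projecting a vector outside it leaves a nonzero [v] orthogonal
    to the kernel; a multiple of [v] represents [f]. *)
Lemma riesz_representation (f : V -> R[i]) (C : R) :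
  (forall c x y, f (c *: x + y) = c * f x + f y) ->
  (forall x, `|f x| <= C%:C * `|x|) -> exists u, forall x, f x = dot x u.
Proof.
move=> fL fC.
have f0 : f 0 = 0.
  by have := fL (-1) 0 0; rewrite scaler0 addr0 mulN1r addNr.
have fB x y : f (x - y) = f x - f y.
  by rewrite -scaleN1r addrC fL mulN1r addrC.
have [fz|/existsNP[x0 fx0]] := pselect (forall x, f x = 0).
  by exists 0 => x; rewrite fz linear0r.
pose M := [set x | f x = 0].
have [|z clz xz] := projection_theorem hdot (M := M) x0.
  split=> // c x y; rewrite /M /= => fx fy.
  by rewrite fL fx fy mulr0 addr0.
have fz : f z = 0 by apply: bounded_vanish_closure fB fC _ _ clz.
set v := x0 - z in xz.
have fv0 : f v != 0 by rewrite fB fz subr0; apply/eqP.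
have v0 : dot v v != 0.
  rewrite dnorm_eq0; apply: contraNneq fv0 => ->; exact/eqP.
exists (((f v)^*%R / dot v v) *: v) => y.
(* This combination is killed by [f], hence orthogonal to [v], which expresses [f y] through
   [dot y v]. *)
have My : M (f v *: y - f y *: v).
  rewrite /M /= addrC -scaleNr fL -[f v *: y]addr0 fL f0 addr0.
  by rewrite mulNr mulrC addNr.
have := dot_eq0C (xz _ My).
rewrite linearBl /= !dotZl => /eqP; rewrite subr_eq0 => /eqP E.
rewrite dotZr rmorphM /= conjCK fmorphV /= geC0_conj ?dnorm_ge0 //.
by rewrite mulrAC E mulfK.
Qed.

Lemma bounded_linear_bound (A : {linear V -> V}) :
  bounded_near A (nbhs (0 : V)) ->
  exists2 C : R, 0 < C & forall x, `|A x| <= C%:C * `|x|.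
Proof.
move=> /linear_boundedP/pinfty_ex_gt0[C C0 AC].
have CE : C = (complex.Re C)%:C by rewrite RRe_real ?gtr0_real.
by exists (complex.Re C); [rewrite -ltr0c -CE | rewrite -CE].
Qed.

(** [adjoint] is a choice from a set of functions; the Riesz theorem, applied for each [y] to the
    functional sending [x] to [dot (A x) y], shows that the set is inhabited. *)
Lemma adjointP (A : {linear V -> V}) : bounded_near A (nbhs (0 : V)) ->
  forall x y, dot (A x) y = dot x (adjoint dot A y).
Proof.
move=> /bounded_linear_bound[C C0 AC].
suff [B AB] : exists B : V -> V, forall x y, dot (A x) y = dot x (B y).
  have := @getPex (V -> V) [set B | forall x y, dot (A x) y = dot x (B y)].
  by apply; exists B.
have /choice[B AB] : forall y, exists u, forall x, dot (A x) y = dot x u.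
  move=> y; have Ly : `|y| = (complex.Re `|y|)%:C by rewrite RRe_real.
  apply: (@riesz_representation _ (C * complex.Re `|y|)).
    by move=> c u v; rewrite linearP linearDl /= dotZl.
  move=> x; apply: le_trans (dot_CauchySchwarz hdot _ _) _.
  by rewrite rmorphM /= -Ly mulrAC ler_wpM2r.
by exists B.
Qed.

(** The imaginary part [J] is symmetric and its range is a line, spanned by a unit vector [g]; so
    [J] is the multiple [k] of the projection on [g], with [k > 0] by dissipativity and nonzero
    rank. *)
Lemma rank_one_decomposition (A : {linear V -> V}) :
  bounded_near A (nbhs (0 : V)) -> dissipative dot A ->
  has_rank (im_part dot A) 1 ->
  exists (H : V -> V) (g : V) (k : R),
    [/\ forall x y, dot (H x) y = dot x (H y), dot g g = 1, 0 < k
      & forall x, A x = H x + ('i * k%:C * dot x g) *: g].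
Proof.
move=> /adjointP; set J := im_part dot A; set T := adjoint dot A.
move=> AT Jge0 [e eI eJ].
have TA x y : dot (T x) y = dot x (A y) by rewrite dotC -AT -dotC.
have conji : Num.conj ('i : R[i]) = - 'i by rewrite conjCi.
have Jsym x y : dot (J x) y = dot x (J y).
  rewrite /J /im_part -/T dotZl dotZr linearBl [dot x (_ - _)]linearBr /= AT TA.
  rewrite fmorphV rmorphM /= conji conjC_nat mulrN invrN mulNr -mulrN.
  by rewrite opprB.
have i0 : (2 * 'i : R[i]) != 0.
  by rewrite mulf_neq0 ?pnatr_eq0 // neq0Ci.
pose e0 := e ord0.
have e00 : e0 != 0.
  apply/eqP => e00; have := eI (fun=> 1); rewrite big_ord1 scale1r.
  by move=> /(_ e00 ord0)/eqP; rewrite oner_eq0.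
have Je x : exists c, J x = c *: e0.
  have : lin_span e (J x) by rewrite eJ; exists x.
  move=> [s [c ->]]; exists (\sum_(i <- s) c i).
  by rewrite scaler_suml; apply: eq_bigr => i _; rewrite (ord1 i).
have [x1 _ x1e] : range J e0.
  by rewrite -eJ; exists [:: ord0], (fun=> 1); rewrite big_seq1 scale1r.
pose g := `|e0|^-1 *: e0.
have ne0 : `|e0| != 0 by rewrite normr_eq0.
have gg : dot g g = 1.
  rewrite dnormZ hdot ger0_norm ?invr_ge0 // -exprMn mulVf //.
  by rewrite expr1n.
have Jg x : J x = dot (J x) g *: g.
  have [c ->] := Je x.
  have -> : c *: e0 = (c * `|e0|) *: g by rewrite scalerA mulfK.
  by rewrite dotZl gg mulr1.
clearbody g; pose l := dot (J g) g.
(* Symmetry moves [J] onto [g], where it acts as the real scalar [l]. *)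
have JE x : J x = (l * dot x g) *: g.
  rewrite Jg Jsym (Jg g) -/l dotZr geC0_conj //; exact: Jge0.
have lE : l = (complex.Re l)%:C by rewrite RRe_real // ger0_real // Jge0.
have l0 : 0 < complex.Re l.
  rewrite -ltr0c -lE lt0r Jge0 andbT; apply: contraNneq e00 => l0.
  by rewrite -x1e JE l0 mul0r scale0r.
(* This [H] is [A] minus ['i] times [J], the real part of [A]. *)
exists (fun x => A x - ('i * l * dot x g) *: g), g, (complex.Re l).
split=> //; last by move=> x; rewrite -lE subrK.
move=> x y.
have AJ : T y = A y - (2 * 'i) *: J y.
  by rewrite /J /im_part scalerA divff // scale1r opprB addrC subrK.
rewrite linearBl /= AT AJ JE !(linearBr dot x) /= !dotZl !dotZr.
rewrite !rmorphM /= conji conjC_nat lE.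
have -> : (((complex.Re l)%:C)^*)%R = (complex.Re l)%:C.
  by rewrite -lE geC0_conj ?Jge0.
rewrite -(dotC dot g y); ring.
Qed.

(** The complement of [K] is orthogonal to [g], so the rank one term vanishes there and [A] agrees
    with the symmetric [H]; the complement thus reduces [A] to a self-adjoint operator. *)
Lemma prime_orth_compl_trivial (A H : V -> V) (g : V) c (K : set V) :
  prime_operator dot A ->
  (forall x y, dot (H x) y = dot x (H y)) ->
  (forall x, A x = H x + (c * dot x g) *: g) ->
  K g -> invariant_under H (orth_compl dot K) ->
  orth_compl dot K = [set 0].
Proof.
move=> Aprime Hsym AH Kg KH; set W := orth_compl dot K.
have AW x : W x -> A x = H x.
  by move=> Wx; rewrite AH Wx // mulr0 scale0r addr0.
(* Here [x] is arbitrary, so this gives both self-adjointness on [W] and invariance of the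
   complement of [W]. *)
have AWl x y : W y -> dot (A x) y = dot x (H y).
  by move=> Wy; rewrite AH linearDl /= dotZl (dot_eq0C (Wy _ Kg)) mulr0 addr0.
apply: Aprime; last by move=> x y _ Wy; rewrite AWl // AW.
split.
- split=> [k _|a x y Wx Wy k Kk]; first by rewrite linear0l.
  by rewrite linearDl /= dotZl Wx // Wy // mulr0 addr0.
- apply/closure_id/seteqP; split; first exact: subset_closure.
  move=> z clz k Kk.
  have kE : `|k| = (complex.Re `|k|)%:C by rewrite RRe_real.
  apply: (@bounded_vanish_closure (dot^~ k) (complex.Re `|k|) W) clz.
  + by move=> x y; rewrite linearBl.
  + by move=> x; rewrite -kE mulrC; apply: dot_CauchySchwarz.
  + by move=> x Wx; apply: Wx.
- by move=> x Wx; rewrite AW //; apply: KH.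
- by move=> x Wx y Wy; rewrite AWl //; apply/Wx/KH.
Qed.

End BoundedOperators.

(** * Finite spans and comparison of dimensions *)

Section Dimension.
Context {R : realType} {V : lmodType R[i]}.

(** The index lists in [lin_span] may repeat entries; collecting coefficients over a duplicate-free
    list makes two combinations addable term by term. *)
Lemma sum_scale_uniq (I : eqType) (f : I -> V) (c : I -> R[i]) (s r : seq I) :
  uniq r -> {subset s <= r} ->
  exists d : I -> R[i], \sum_(i <- s) c i *: f i = \sum_(i <- r) d i *: f i.
Proof.
move=> rU; elim: s => [|i s IH] sr.
  by exists (fun=> 0); rewrite big_nil big1 // => i _; rewrite scale0r.
have [|d dE] := IH; first by move=> j js; apply: sr; rewrite in_cons js orbT.
exists (fun j => (if j == i then c i else 0) + d j).
rewrite big_cons dE; under [RHS]eq_bigr do rewrite scalerDl.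
rewrite big_split /=; congr (_ + _).
rewrite (bigD1_seq i) //=; last by rewrite sr // mem_head.
rewrite eqxx big1 ?addr0 // => j /negPf ->.
by rewrite scale0r.
Qed.

Lemma lin_spanE n (f : 'I_n -> V) x :
  lin_span f x -> exists c : 'I_n -> R[i], x = \sum_i c i *: f i.
Proof.
move=> [s [c ->]]; apply: sum_scale_uniq; first exact: index_enum_uniq.
by move=> i _; apply: mem_index_enum.
Qed.

Lemma linear_subspace_lin_span (I : eqType) (f : I -> V) :
  linear_subspace (lin_span f).
Proof.
split; first by exists [::], (fun=> 0); rewrite big_nil.
move=> a x y [s [c ->]] [t [d ->]].
have rU := undup_uniq (s ++ t).
have [|c' ->] := sum_scale_uniq f c (s := s) rU.
  by move=> i si; rewrite mem_undup mem_cat si.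
have [|d' ->] := sum_scale_uniq f d (s := t) rU.
  by move=> i ti; rewrite mem_undup mem_cat ti orbT.
exists (undup (s ++ t)), (fun i => a * c' i + d' i).
rewrite scaler_sumr -big_split; apply: eq_bigr => i _ /=.
by rewrite scalerDl scalerA.
Qed.

Lemma lin_span_mem (I : Type) (f : I -> V) i : lin_span f (f i).
Proof. by exists [:: i], (fun=> 1); rewrite big_seq1 scale1r. Qed.

(** If [n < m], the [m] by [n] matrix of coordinates has a nonzero row in its left kernel, which is
    a linear relation among the [e i]. *)
Lemma lin_independent_leq m n (e : 'I_m -> V) (f : 'I_n -> V) :
  lin_independent e -> (forall i, lin_span f (e i)) -> (m <= n)%N.
Proof.
move=> eI ef; have /choice[C eC] i := lin_spanE (ef i).
rewrite leqNgt; apply/negP => nm.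
pose M := \matrix_(i < m, j < n) C i j.
have /rowV0Pn[v /sub_kermxP vM /eqP []] : kermx M != 0.
  by rewrite -mxrank_eq0 mxrank_ker subn_eq0 -ltnNge
    (leq_ltn_trans (rank_leq_col M)).
apply/rowP => i; rewrite [RHS]mxE; apply: (eI (fun i => v 0 i)) => {i}.
under eq_bigr => i _ do rewrite eC scaler_sumr.
rewrite exchange_big /= big1 // => j _.
under eq_bigr => i _ do rewrite scalerA.
rewrite -scaler_suml.
have /matrixP/(_ 0 j) := vM; rewrite !mxE => vMj.
rewrite -[X in X *: _](_ : \sum_i v 0 i * M i j = _).
  by rewrite vMj scale0r.
by apply: eq_bigr => i _; rewrite mxE.
Qed.

End Dimension.

(** * The Lanczos recursion for a symmetric operator *)

Section Lanczos.
Context {R : realType} {V : completeNormedModType R[i]}.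
Variable dot : {dot V for Num.conj}.
Hypothesis hdot : induces_norm dot.
Variables (H : V -> V) (g : V).
Hypothesis Hsym : forall x y, dot (H x) y = dot x (H y).
Hypothesis gg : dot g g = 1.

(* The state at step k is (a_(k-1) e_(k-1), e_k); a vanishing residual makes all
   later vectors 0, since 0^-1 = 0. *)
Definition lanczos_step (s : V * V) : V * V :=
  let u := H s.2 - dot (H s.2) s.2 *: s.2 - s.1 in (`|u| *: s.2, `|u|^-1 *: u).

(** The initial 0 stands for the missing previous term, so the recursion has the same form at
    [k = 0]. *)
Definition lanczos_state k := iter k lanczos_step (0, g).
Definition lanczos_prev k := (lanczos_state k).1.
Definition lanczos_vec k := (lanczos_state k).2.
Definition lanczos_diag k : R[i] := dot (H (lanczos_vec k)) (lanczos_vec k).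
Definition lanczos_residual k :=
  H (lanczos_vec k) - lanczos_diag k *: lanczos_vec k - lanczos_prev k.
Definition lanczos_off k : R[i] := `|lanczos_residual k|.

Local Notation e := lanczos_vec.
Local Notation p := lanczos_prev.
Local Notation b := lanczos_diag.
Local Notation a := lanczos_off.
Local Notation u := lanczos_residual.

Lemma lanczos_prevS k : p k.+1 = a k *: e k.
Proof. by rewrite /p /lanczos_state iterS. Qed.

Lemma lanczos_vecS k : e k.+1 = (a k)^-1 *: u k.
Proof. by rewrite /e /lanczos_state iterS. Qed.

Lemma lanczos_off_vec k : a k *: e k.+1 = u k.
Proof.
rewrite lanczos_vecS scalerA; have [a0|a0] := eqVneq (a k) 0.
  by rewrite a0 mul0r scale0r; apply/esym/normr0_eq0.
by rewrite divff // scale1r.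
Qed.

Lemma lanczos_rec k : H (e k) = p k + b k *: e k + a k *: e k.+1.
Proof.
rewrite lanczos_off_vec /u -[_ - _ - _]addrA -opprD.
by rewrite [p k + _]addrC [RHS]addrC subrK.
Qed.

Lemma lanczos_off_conj k : ((a k)^*)%R = a k.
Proof. exact/geC0_conj/normr_ge0. Qed.

Lemma lanczos_diag_conj k : ((b k)^*)%R = b k.
Proof. by rewrite -dotC -Hsym. Qed.

Lemma lanczos_vecS_norm k : dot (e k.+1) (e k.+1) = (a k != 0)%:R.
Proof.
rewrite lanczos_vecS dnormZ hdot normfV normr_id -/(a k) -exprMn.
have [->|a0] := eqVneq (a k) 0; first by rewrite mulr0 expr0n.
by rewrite mulVf // expr1n.
Qed.

Lemma lanczos_vec_eq0 k : a k = 0 -> e k.+1 = 0.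
Proof. by move=> a0; rewrite lanczos_vecS a0 invr0 scale0r. Qed.

(** Breakdown is permanent: once [e k.+1] and the term carried over vanish, so does the next
    residual. *)
Lemma lanczos_off_eq0 k : a k = 0 -> a k.+1 = 0.
Proof.
move=> a0; apply/eqP; rewrite normr_eq0 /u lanczos_prevS a0 scale0r subr0.
rewrite lanczos_vec_eq0 // scaler0 subr0 -(dnorm_eq0 dot).
by rewrite Hsym linear0l.
Qed.

Lemma lanczos_vec_norm k : a k != 0 -> dot (e k) (e k) = 1.
Proof.
case: k => [|k] ak; first exact: gg.
rewrite lanczos_vecS_norm; have [a0|//] := eqVneq (a k) 0.
by rewrite lanczos_off_eq0 // eqxx in ak.
Qed.

Lemma lanczos_vec_norm01 k : dot (e k) (e k) = 1 \/ e k = 0.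
Proof.
case: k => [|k]; first by left; exact: gg.
rewrite lanczos_vecS_norm; have [a0|a0] := eqVneq (a k) 0; last by left.
by right; apply: lanczos_vec_eq0.
Qed.

(** Induction on [n] for all pairs up to [n]. Against [e n], the diagonal term cancels. Against an
    earlier [e j], symmetry moves [H] onto [e j], whose image involves no vector past [e j.+1]. *)
Lemma lanczos_orth_lt n j : (j < n)%N -> dot (e n) (e j) = 0.
Proof.
suff O : forall i j, (j < i <= n)%N -> dot (e i) (e j) = 0.
  by move=> jn; apply: O; rewrite jn leqnn.
elim: n {j} => [|n IH] i j /andP[ji].
  by rewrite leqn0 => /eqP i0; rewrite i0 in ji.
rewrite leq_eqVlt ltnS => /predU1P[i_n|in_]; last by apply: IH; rewrite ji.
rewrite {i}i_n in ji *; rewrite ltnS in ji.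
have IH' k l : (k < l <= n)%N -> dot (e k) (e l) = 0.
  by move=> kl; apply/dot_eq0C/IH.
rewrite lanczos_vecS dotZl.
suff -> : dot (u n) (e j) = 0 by rewrite mulr0.
rewrite /u !linearBl /= dotZl.
move: ji; rewrite leq_eqVlt => /predU1P[->|jn].
  have -> : dot (p n) (e n) = 0.
    case: n IH IH' => [|n] IH IH'; first by rewrite linear0l.
    by rewrite lanczos_prevS dotZl IH' ?mulr0 ?ltnSn ?leqnn.
  rewrite subr0 -/(b n).
  by case: (lanczos_vec_norm01 n) => E;
    rewrite E ?mulr1 ?subrr // /b E !linear0r subrr.
case: n IH IH' jn => // n IH IH' jn.
rewrite IH ?jn ?leqnn // mulr0 subr0 lanczos_prevS dotZl.
have -> : dot (H (e n.+1)) (e j) = a j * dot (e n.+1) (e j.+1).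
  rewrite Hsym lanczos_rec !linearDr /= !dotZr lanczos_off_conj.
  rewrite (IH n.+1 j) ?jn ?leqnn // mulr0 addr0.
  case: j jn => [|j] jn; first by rewrite linear0r add0r.
  by rewrite lanczos_prevS dotZr IH ?mulr0 ?add0r // (ltnW jn) leqnn.
(* For [j = n] both terms equal [a n], also at breakdown; for smaller [j] both are zero. *)
move: jn; rewrite ltnS leq_eqVlt => /predU1P[->|jn].
  have [->|a0] := eqVneq (a n) 0; first by rewrite !mul0r subrr.
  by rewrite lanczos_vecS_norm a0 lanczos_vec_norm // subrr.
by rewrite !IH ?mulr0 ?subrr // ?jn ?leqnSn // ltnS jn leqnn.
Qed.

Lemma lanczos_orth j k : j != k -> dot (e j) (e k) = 0.
Proof.
by rewrite neq_ltn => /orP[]/lanczos_orth_lt // /dot_eq0C.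
Qed.

(** Pairing the recursion with [e j] leaves one term at most. This remains valid past a breakdown,
    where the vectors and off-diagonal coefficients vanish together. *)
Lemma lanczos_jacobi j k : dot (H (e k)) (e j) = jacobi_entry b a j k.
Proof.
have off m : a m * dot (e m.+1) (e m.+1) = a m.
  by rewrite lanczos_vecS_norm; have [->|] := eqVneq; rewrite ?mul0r ?mulr1.
have pE : dot (p k) (e j) = if k == j.+1 then a j else 0.
  case: k => [|k]; first by rewrite linear0l.
  rewrite lanczos_prevS dotZl eqSS; have [->|kj] := eqVneq k j.
    have [->|a0] := eqVneq (a j) 0; first by rewrite mul0r.
    by rewrite lanczos_vec_norm // mulr1.
  by rewrite lanczos_orth // mulr0.
rewrite {1}lanczos_rec !linearDl /= (dotZl dot (b k)) (dotZl dot (a k)).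
rewrite /jacobi_entry pE.
have [->|jk] := eqVneq j k.
  rewrite ltn_eqF // add0r (lanczos_orth (j := k.+1)) ?gtn_eqF // mulr0 addr0.
  by case: (lanczos_vec_norm01 k) => E; rewrite E ?mulr1 // /b E !linear0r.
rewrite (lanczos_orth (j := k)) 1?eq_sym // mulr0 addr0.
have [->|kj] := eqVneq k j.+1.
  by rewrite (lanczos_orth (j := j.+2)) ?mulr0 ?addr0 // gtn_eqF.
rewrite add0r; have [->|jSk] := eqVneq j k.+1; first exact: off.
by rewrite lanczos_orth 1?eq_sym // mulr0.
Qed.

Lemma lanczos_invariant :
  invariant_under H (orth_compl dot (range e)).
Proof.
move=> w We _ [k _ <-].
rewrite Hsym lanczos_rec !linearDr /= (dotZr dot (b k)) (dotZr dot (a k)).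
have {}We l : dot w (e l) = 0 by apply: We; exists l.
rewrite !We !mulr0 !addr0.
case: k => [|k]; first exact: linear0r.
by rewrite lanczos_prevS dotZr We mulr0.
Qed.

(** Only [e j] has to precede the breakdown: for [k != j] orthogonality holds even if [e k] is 0. *)
Lemma lanczos_orthonormal j k : (forall i, (i < j)%N -> a i != 0) ->
  dot (e j) (e k) = (j == k)%:R.
Proof.
move=> aj; have [<-|jk] := eqVneq j k; last exact: lanczos_orth.
case: j aj => [|j] aj; first exact: gg.
by rewrite lanczos_vecS_norm aj.
Qed.

Hypothesis complete : orth_compl dot (range e) = [set 0].

Lemma lanczos_closure : closure (lin_span e) = setT.
Proof.
apply/seteqP; split=> // x _.
have [z clz xz] := projection_theorem hdot x (linear_subspace_lin_span e).
suff /eqP : x - z = 0 by rewrite subr_eq0 => /eqP ->.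
suff : orth_compl dot (range e) (x - z) by rewrite complete.
by move=> _ [k _ <-]; apply/xz/lin_span_mem.
Qed.

(** The error of the expansion is orthogonal to [e k] for [k <= n] by orthonormality, and for
    [k > n] because [e k = 0]. *)
Lemma lanczos_expansion n x : a n = 0 ->
  (forall i, (i < n)%N -> a i != 0) ->
  x = \sum_(i < n.+1) dot x (e i) *: e i.
Proof.
move=> an ai; apply/eqP; rewrite -subr_eq0; apply/eqP.
set y := _ - _; suff : orth_compl dot (range e) y by rewrite complete.
move=> _ [k _ <-]; rewrite /y linearBl linear_sumlz /=.
have [kn|nk] := ltnP k n.+1.
  rewrite (bigD1 (Ordinal kn)) //= big1 ?addr0.
    rewrite dotZl lanczos_orthonormal ?eqxx ?mulr1 ?subrr // => i ik.
    by apply: ai; apply: leq_trans ik _.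
  move=> i ik; rewrite dotZl lanczos_orth ?mulr0 //.
have -> : e k = 0.
  have {nk} : exists m, k = (n + m).+1.
    by exists (k - n.+1)%N; rewrite -addSn subnKC.
  move=> [m ->]; apply: lanczos_vec_eq0.
  by elim: m => [|m IH]; rewrite ?addn0 // addnS lanczos_off_eq0.
by rewrite linear0r big1 ?subrr // => i _; rewrite linear0r.
Qed.

End Lanczos.

(** * Independence and matrix entry bounds for orthonormal families *)

Section OrthonormalFamilies.
Context {R : realType} {V : completeNormedModType R[i]}.
Variable dot : {dot V for Num.conj}.
Hypothesis hdot : induces_norm dot.

Lemma orthonormal_independent n (e : 'I_n -> V) :
  orthonormal_family dot e -> lin_independent e.
Proof.
move=> eo c c0 i; have := linear0l dot (e i).
rewrite -c0 linear_sumlz /= (bigD1 i) //= big1 => [|j /negPf ji].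
  by rewrite addr0 dotZl eo eqxx mulr1.
by rewrite dotZl eo ji mulr0.
Qed.

Lemma op_entry_norm_le (A : V -> V) (C : R) (I : eqType) (e : I -> V) j k :
  (forall x, `|A x| <= C%:C * `|x|) -> orthonormal_family dot e ->
  `|op_entry dot A e j k| <= C%:C.
Proof.
move=> AC eo; have e1 i : `|e i| = 1.
  by apply/eqP; rewrite -(@pexpr_eq1 _ _ 2) // -hdot eo eqxx.
apply: le_trans (dot_CauchySchwarz hdot _ _) _.
by rewrite e1 mulr1; have := AC (e k); rewrite e1 mulr1.
Qed.

End OrthonormalFamilies.

(** * Assembly of the Jacobi matrix in finite and infinite dimension *)

Theorem theorem6p1 (R : realType) (V : completeNormedModType R[i])
    (dot : {dot V for Num.conj}) (hdot : induces_norm dot)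
    (hsep : separable V)
    (A : {linear V -> V}) (hbdd : bounded_near A (nbhs (0 : V)))
    (hprime : prime_operator dot A)
    (hdiss : dissipative dot A)
    (hrank : has_rank (im_part dot A) 1) :
  (forall n : nat, has_dim [set: V] n ->
     exists (e : 'I_n -> V) (b a : nat -> R[i]),
       [/\ orthonormal_basis dot e,
           \matrix_(j < n, k < n) op_entry dot A e j k = jacobi_mx n b a,
           0 < complex.Im (b 0%N),
           forall k : nat, (0 < k < n)%N -> b k \is Num.real
         & forall k : nat, (k.+1 < n)%N -> 0 < a k])
  /\
  (infinite_dim [set: V] ->
     exists (e : nat -> V) (b a : nat -> R[i]),
       orthonormal_basis dot e /\
       [/\ forall j k : nat, op_entry dot A e j k = jacobi_entry b a j k,
           jacobi_bounded b a,
           0 < complex.Im (b 0%N),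
           forall k : nat, (0 < k)%N -> b k \is Num.real
         & forall k : nat, 0 < a k]).
Proof.
have [H [g [k0 [Hsym gg k0_gt0 AH]]]] :=
  rank_one_decomposition hdot hbdd hdiss hrank.
have [C C0 AC] := bounded_linear_bound hbdd.
pose e := lanczos_vec dot H g; pose a := lanczos_off dot H g.
pose b k : R[i] := lanczos_diag dot H g k + (k == 0%N)%:R * ('i%R * k0%:C).
have complete : orth_compl dot (range e) = [set 0].
  apply: (prime_orth_compl_trivial hdot hprime Hsym AH); first by exists 0%N.
  exact: lanczos_invariant.
have eg k : dot (e k) g = (k == 0%N)%:R.
  case: k => [|k]; first exact: gg.
  exact: (lanczos_orth hdot Hsym gg (j := k.+1) (k := 0%N)).
have entry j k : dot (A (e k)) (e j) = jacobi_entry b a j k.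
  rewrite AH linearDl /= dotZl (lanczos_jacobi hdot Hsym gg).
  rewrite eg [dot g _]dotC eg conjC_nat /jacobi_entry.
  have [->|jk] := eqVneq j k.
    by rewrite /b; case: (k == 0%N); rewrite ?mulr1 ?mul1r // !(mulr0, mul0r).
  (* Off the diagonal the rank one term contributes nothing, as [j] and [k] are not both 0. *)
  rewrite -!mulrA.
  have -> : (k == 0%N)%:R * (j == 0%N)%:R = 0 :> R[i].
    rewrite -natrM mulnb; suff -> : (k == 0%N) && (j == 0%N) = false by [].
    by apply: contraNF jk => /andP[/eqP-> /eqP->].
  by rewrite !mulr0 addr0.
have b0 : 0 < complex.Im (b 0%N).
  have dE : lanczos_diag dot H g 0 = (complex.Re (lanczos_diag dot H g 0))%:C.
    by rewrite RRe_real // CrealE lanczos_diag_conj.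
  rewrite /b dE mul1r -complexiE /=; lra.
have bk k : (0 < k)%N -> b k \is Num.real.
  case: k => // k _; rewrite /b mul0r addr0 CrealE.
  by rewrite lanczos_diag_conj.
(* Breakdown of the recursion decides the dimension: the first zero [a m] forces dimension [m.+1],
   which also refutes infinite dimension. *)
have [[N aN]|aN] := pselect (exists N, a N == 0).
  have exN : exists N, a N == 0 by exists N.
  case: (ex_minnP exN) => m /eqP am am_min {N aN exN}.
  have ai i : (i < m)%N -> a i != 0.
    by move=> im; apply: contraTneq im => /eqP /am_min; rewrite -leqNgt.
  pose f (i : 'I_m.+1) := e i.
  have fo : orthonormal_family dot f.
    move=> i j; rewrite /f (lanczos_orthonormal hdot Hsym gg) // => l li.
    by apply: ai; apply: leq_trans li _; rewrite -ltnS.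
  have fspan x : lin_span f x.
    rewrite (lanczos_expansion hdot Hsym gg complete x am ai).
    by exists (index_enum 'I_m.+1), (fun i => dot x (e i)).
  have fI := orthonormal_independent fo.
  split=> [n [h hI hspan]|]; last first.
    move=> /(_ m.+1) []; exists f => //.
    by apply/seteqP; split.
  have -> : n = m.+1.
    apply/eqP; rewrite eqn_leq (lin_independent_leq (f := f) hI) //=.
    by rewrite (lin_independent_leq (f := h) fI) // => i; rewrite hspan.
  exists f, b, a; split=> //.
  - split=> //; apply/seteqP; split=> // x _; exact/subset_closure.
  - by apply/matrixP => j k; rewrite !mxE /op_entry entry.
  - by move=> k /andP[k_gt0 _]; apply: bk.
  - by move=> k; rewrite ltnS => km; rewrite lt0r ai // /a normr_ge0.
have ai i : a i != 0 by apply/negP => ai; apply: aN; exists i.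
have eo : orthonormal_family dot e.
  by move=> j k; rewrite (lanczos_orthonormal hdot Hsym gg).
(* Without breakdown, [n.+1] orthonormal vectors contradict dimension [n]. *)
split=> [n [h hI hspan]|_].
  have fo : orthonormal_family dot (fun i : 'I_n.+1 => e i).
    by move=> i j; apply: eo.
  have := lin_independent_leq (orthonormal_independent fo) (f := h).
  by rewrite ltnn hspan => /(_ (fun=> I)).
exists e, b, a; split; first by split=> //; apply: lanczos_closure.
split=> //; last by move=> k; rewrite lt0r ai /a normr_ge0.
(* Both [a k] and [b k] are matrix entries of [A] between unit vectors, each bounded by [C]. *)
exists (C + C) => k; rewrite rmorphD; apply: lerD.
  have -> : a k = op_entry dot A e k k.+1.
    by rewrite /op_entry entry /jacobi_entry ltn_eqF // eqxx.
  exact: op_entry_norm_le AC eo.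
have -> : b k = op_entry dot A e k k.
  by rewrite /op_entry entry /jacobi_entry eqxx.
exact: op_entry_norm_le AC eo.
Qed.
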